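(* Let $(\Omega,\mathcal{F},\mathbb{P})$ be a probability space and $\{\mathcal{F}_t\}_{t\in\mathbb{R}_+}$ a filtration (not assumed to satisfy the usual conditions) with $\bigvee_{t\in\mathbb{R}_+}\mathcal{F}_t\subseteq\mathcal{F}$. For every predictable set $P\subseteq\Omega\times\mathbb{R}_+$ and every $\epsilon>0$ there exists a predictable time $\rho^{P,\epsilon}$ such that $[\![\rho^{P,\epsilon}]\!]\subseteq P$ and $$\mathbb{P}^*\left(\pi_\Omega(P)\right)-\mathbb{P}\left(\{\rho^{P,\epsilon}<\infty\}\right)\leq\epsilon .$$
   Context: $\mathbb{R}_+=[0,\infty)$. No completeness or right-continuity of the filtration is assumed. An optional time (stopping time) is a function $\tau:\Omega\to\mathbb{R}_+\cup\{\infty\}$ with $\{\tau\le t\}\in\mathcal{F}_t$ for all $t\in\mathbb{R}_+$. A predictable time is an optional time $\rho$ for which there exists a non-decreasing sequence of optional times $\{\rho_n\}_{n\in\mathbb{N}}$ such that, for all $n$, $\rho_n<\infty$, $\rho_n\le\rho$, and $\rho_n<\rho$ on $\{0<\rho\}$, and such that $\rho_n\nearrow\rho$; all these relations hold for every $\omega\in\Omega$ (no reference to $\mathbb{P}$). For a function $\tau:\Omega\to\mathbb{R}_+\cup\{\infty\}$, its graph is $[\![\tau]\!]=\{(\omega,\tau(\omega)):\omega\in\Omega,\ \tau(\omega)<\infty\}$, and $[\![\tau,\infty[\![=\{(\omega,t)\in\Omega\times\mathbb{R}_+:\tau(\omega)\le t\}$. The predictable $\sigma$-algebra on $\Omega\times\mathbb{R}_+$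 is the $\sigma$-algebra generated by the sets $[\![\rho,\infty[\![$ with $\rho$ a predictable time; its elements are the predictable sets. $\pi_\Omega:\Omega\times\mathbb{R}_+\to\Omega$ is the projection $\pi_\Omega(\omega,t)=\omega$. For $A\subseteq\Omega$, $\mathbb{P}^*(A)=\inf\{\mathbb{P}(E):A\subseteq E,\ E\in\mathcal{F}\}$. *)

(* Defs.v *)
From mathcomp Require Import all_boot all_order all_algebra.
From mathcomp Require Import interval_inference.
From mathcomp Require Import all_classical all_reals all_analysis.

Set Implicit Arguments.
Unset Strict Implicit.
Unset Printing Implicit Defensive.

Import Order.TTheory GRing.Theory Num.Theory.
Import numFieldNormedType.Exports.

Local Open Scope classical_set_scope.
Local Open Scope ring_scope.
Local Open Scope ereal_scope.

(* The time axis is the subtype {nonneg R} of R; random times take their values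
   in \bar R, nonnegativity being part of [is_optional_time]. *)

Section predictable.
Context {T : Type} {R : realType}.

(* Neither completeness nor right-continuity is required. *)
Definition is_filtration (F : {nonneg R} -> set (set T)) : Prop :=
  (forall t, sigma_algebra [set: T] (F t)) /\
  (forall s t : {nonneg R}, (s%:num <= t%:num)%R -> F s `<=` F t).

Definition is_optional_time (F : {nonneg R} -> set (set T))
    (tau : T -> \bar R) : Prop :=
  (forall w, 0 <= tau w) /\
  (forall t : {nonneg R}, F t [set w | tau w <= t%:num%:E]).

(* All relations hold for every w; there is no exceptional null set. *)
Definition announces (rho_ : nat -> T -> \bar R) (rho : T -> \bar R) : Prop :=
  [/\ forall w, nondecreasing_seq (rho_ ^~ w),
      forall n w, rho_ n w < +oo,
      forall n w, rho_ n w <= rho w,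
      forall n w, 0 < rho w -> rho_ n w < rho w &
      forall w, rho_ n w @[n --> \oo] --> rho w].

Definition is_predictable_time (F : {nonneg R} -> set (set T))
    (rho : T -> \bar R) : Prop :=
  is_optional_time F rho /\
  exists rho_ : nat -> T -> \bar R,
    (forall n, is_optional_time F (rho_ n)) /\ announces rho_ rho.

Definition time_graph (tau : T -> \bar R) : set (T * {nonneg R}) :=
  [set x | tau x.1 = x.2%:num%:E].

Definition time_epigraph (tau : T -> \bar R) : set (T * {nonneg R}) :=
  [set x | tau x.1 <= x.2%:num%:E].

Definition predictable_sigma_algebra (F : {nonneg R} -> set (set T)) :
    set (set (T * {nonneg R})) :=
  <<s [set time_epigraph rho | rho in is_predictable_time F] >>.

End predictable.

(* The library's [mu_ext] is instead an infimum over countable covers. *)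
Definition outer_probability (d : measure_display) (T : measurableType d)
    (R : realType) (P : probability T R) (A : set T) : \bar R :=
  ereal_inf [set P E | E in [set E | A `<=` E /\ measurable E]].

(* Main.v *)
Require Import Defs.
From mathcomp Require Import all_boot all_order all_algebra.
From mathcomp Require Import interval_inference.
From mathcomp Require Import all_classical all_reals all_analysis.

Set Implicit Arguments.
Unset Strict Implicit.
Unset Printing Implicit Defensive.

Import Order.TTheory GRing.Theory Num.Theory.

Local Open Scope classical_set_scope.
Local Open Scope ring_scope.
Local Open Scope ereal_scope.

(** The idea is to approximate [S] from inside, in the sense of Choquet, by sets whose
debut is a predictable time, and to take the debut of the approximating set as [rho].

The approximating sets are built from the stochastic intervals
[{(w, t) | sigma w <= t <= tau w}] with [sigma] predictable and [tau] optional. They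
are stable under finite intersections, and the debut of such an interval is [sigma]
where [sigma <= tau] and [+oo] elsewhere. This is a predictable time for any
filtration ([predictable_restrict]): if [sigma_n] announces [sigma], then the optional
times equal to [sigma_n] where [sigma_n <= tau] and to [+oo] elsewhere foretell it.
A finite union of intervals has as debut the minimum of the debuts, which is again
predictable and is attained.

Every epigraph of a predictable time [rho] is an interval, and if [rho_n] announces
[rho], then the complement of the epigraph is the countable union of the intervals
[{0 <= t <= rho_n w, 0 < rho w}]. Hence every predictable set is analytic over the
paving of intervals ([predictable_analytic]), and Choquet's theorem
([capacitability]) applies to the sets [K] such that the outer probability of the
projection of [K], restricted to times at most [N], exceeds [a]: this property is
preserved by supersets and, for increasing unions, inherited by some member of the
sequence ([outer_probability_bigcup]). With [a] equal to the outer probability of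
the projection of [S] minus [eps], it gives finite unions of intervals [K_n],
decreasing, with intersection inside [S], all of which have this property.

Let [rho_n] be the debut of [K_n] and [rho] the supremum of the [rho_n], a predictable
time. Since the sections of the [K_n] are closed, the graph of [rho] lies in every [K_n]
([debut_bigcap]), hence in [S]. The events [rho_n <= N] decrease to [rho <= N]
and each has probability at least [a], so [P (rho < +oo) >= P (rho <= N) >= a]. *)

(** * Sequences that agree up to a given rank *)

Definition agree (n : nat) (f g : nat -> nat) :=
  forall k, (k < n)%N -> f k = g k.

Lemma agree_le m n f g : (m <= n)%N -> agree n f g -> agree m f g.
Proof. by move=> mn fg k km; apply: fg; apply: leq_trans mn. Qed.

Lemma agree_sym n f g : agree n f g -> agree n g f.
Proof. by move=> fg k kn; rewrite fg. Qed.

Lemma agree_trans n f g h : agree n f g -> agree n g h -> agree n f h.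
Proof. by move=> fg gh k kn; rewrite fg // gh. Qed.

Definition update (f : nat -> nat) (n v : nat) : nat -> nat :=
  fun k => if k == n then v else f k.

Lemma agree_update2 n v f g : agree n f g ->
  agree n.+1 (update f n v) (update g n v).
Proof.
move=> fg k; rewrite ltnS leq_eqVlt /update => /predU1P[->|kn]; first by rewrite eqxx.
by rewrite ltn_eqF// fg.
Qed.

Lemma agree_update_eq n f g : agree n f g -> agree n.+1 f (update g n (f n)).
Proof.
move=> fg k; rewrite ltnS leq_eqVlt /update => /predU1P[->|kn]; first by rewrite eqxx.
by rewrite ltn_eqF// fg.
Qed.

(** Dependent choice for properties of finite prefixes: each step fixes one more
    coordinate, and the coordinates chosen so far form the limit sequence. *)
Lemma infinite_branch (Q : nat -> (nat -> nat) -> Prop) f0 :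
  (forall n f g, agree n f g -> Q n f -> Q n g) ->
  Q 0%N f0 ->
  (forall n f, Q n f -> exists v, Q n.+1 (update f n v)) ->
  exists f, forall n, Q n f.
Proof.
move=> Qagree Q0 Qstep.
have /choice[v vP] (p : nat * (nat -> nat)) :
    exists v, Q p.1 p.2 -> Q p.1.+1 (update p.2 p.1 v).
  have [/Qstep[v Qv]|nQ] := pselect (Q p.1 p.2); last by exists 0%N.
  by exists v.
pose fix fs n := if n is k.+1 then update (fs k) k (v (k, fs k)) else f0.
have Qfs n : Q n (fs n) by elim: n => //= n; exact: (vP (n, fs n)).
have fsE n k : (k < n)%N -> fs n k = fs k.+1 k.
  elim: n => // n IH; rewrite ltnS leq_eqVlt => /predU1P[->//|kn].
  by rewrite -IH//= /update ltn_eqF.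
exists (fun k => fs k.+1 k) => n; apply: Qagree (Qfs n) => k; exact: fsE.
Qed.

(** * Analytic sets and capacitability *)

Section analytic.
Context {X : Type}.
Implicit Types (E : set (set X)) (S : set X) (A : nat -> (nat -> nat) -> set X).

Definition finitely_dependent {Y : Type} (A : (nat -> nat) -> Y) :=
  exists N, forall f g, agree N f g -> A f = A g.

(** The Souslin operation. Asking only for finite dependence, without fixing which
    coordinates the [n]-th set reads, leaves the coordinates free to be renamed, which
    is what countable unions and intersections need. *)
Definition analytic E S := exists A, [/\ forall n f, E (A n f),
  forall n, finitely_dependent (A n) & S = [set x | exists f, forall n, A n f x]].

Lemma analytic_paving E S : E S -> analytic E S.
Proof.
move=> ES; exists (fun _ _ => S); split => //; first by move=> n; exists 0%N.
by apply/seteqP; split => [x Sx|x [f]/(_ 0%N)//]; exists id.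
Qed.

Lemma analytic_countable E (I : countType) (A : I -> (nat -> nat) -> set X) S :
  E setT -> (forall i f, E (A i f)) -> (forall i, finitely_dependent (A i)) ->
  S = [set x | exists f, forall i, A i f x] -> analytic E S.
Proof.
move=> ET EA dA ->.
exists (fun n f => if unpickle n is Some i then A i f else setT); split.
- by move=> n f; case: unpickle.
- by move=> n; case: unpickle => [i|] //; exists 0%N.
- apply/seteqP; split => x [f Af]; exists f.
    by move=> n; case: unpickle.
  by move=> i; have := Af (pickle i); rewrite pickleK.
Qed.

(** The first coordinate names the member of the union to which the others refer. *)
Lemma analytic_bigcup E (S : nat -> set X) : E setT ->
  (forall i, analytic E (S i)) -> analytic E (\bigcup_i S i).
Proof.
move=> ET /choice[A /all_and3[EA dA SA]].
apply: (@analytic_countable _ _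
  (fun (p : nat * nat) f => if f 0%N == p.1 then A p.1 p.2 (fun k => f k.+1)
     else setT)) => //.
- by move=> [i n] f /=; case: ifP.
- move=> [i n] /=; have [N AN] := dA i n; exists N.+1 => f g fg.
  rewrite fg//; case: ifP => // _; apply: AN => k kN; exact: fg.
- apply/seteqP; split => [x [i _]|x [f Af]].
    rewrite SA => -[f Af]; exists (fun k => if k is k'.+1 then f k' else i).
    by move=> [j n] /=; case: eqP => // <-; exact: Af.
  exists (f 0%N) => //; rewrite SA; exists (fun k => f k.+1) => n.
  by have := Af (f 0%N, n); rewrite /= eqxx.
Qed.

(** A sequence of sequences, one for each set, is coded by a single sequence. *)
Lemma analytic_bigcap E (S : nat -> set X) : E setT ->
  (forall i, analytic E (S i)) -> analytic E (\bigcap_i S i).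
Proof.
move=> ET /choice[A /all_and3[EA dA SA]].
apply: (@analytic_countable _ _
  (fun (p : nat * nat) f => A p.1 p.2 (fun k => f (pickle (p.1, k))))) => //.
- move=> [i n] /=; have [N AN] := dA i n.
  exists (\max_(k < N) (pickle (i, k : nat)).+1)%N => f g fg.
  apply: AN => k kN; apply: fg.
  exact: (@leq_bigmax _ (fun k : 'I_N => (pickle (i, k : nat)).+1) (Ordinal kN)).
- apply/seteqP; split => [x Sx|x [f Af] i _]; last first.
    by rewrite SA; exists (fun k => f (pickle (i, k))) => n; exact: (Af (i, n)).
  have /choice[f fP] i : exists f, forall n, A i n f x.
    by have := Sx i I; rewrite SA.
  exists (fun p => if @unpickle (nat * nat)%type p is Some (i, k) then f i k else 0%N).
  move=> [i n] /=; under [X in A _ _ X]eq_fun do rewrite pickleK.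
  exact: fP.
Qed.

(** Analytic sets need not have analytic complements; those that do form a
    sigma-algebra. *)
Lemma analytic_sigma_algebra E (G : set (set X)) : E setT -> E set0 ->
  (forall S, G S -> analytic E S /\ analytic E (~` S)) ->
  <<s G >> `<=` analytic E.
Proof.
move=> ET E0 GE S sS.
suff [] : [set S | analytic E S /\ analytic E (~` S)] S by [].
move: S sS; apply: smallest_sub => //; split => /=.
- by rewrite setC0; split; apply: analytic_paving.
- by move=> A [EA EcA]; rewrite setTD setCK.
- move=> A EA; split; first by apply: analytic_bigcup => // i; case: (EA i).
  by rewrite setC_bigcup; apply: analytic_bigcap => // i; case: (EA i).
Qed.

Lemma bounded_bigcup_closed (U : set (set X)) (V : nat -> set X) M :
  (forall K L, U K -> U L -> U (K `|` L)) -> (forall v, U (V v)) ->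
  U (\bigcup_(v in [set v | (v <= M)%N]) V v).
Proof.
move=> UU UV; elim: M => [|M IH].
  suff -> : \bigcup_(v in [set v | (v <= 0)%N]) V v = V 0%N by [].
  apply/seteqP; split => [x [v /= + Vx]|x Vx]; last by exists 0%N.
  by rewrite leqn0 => /eqP <-.
suff -> : \bigcup_(v in [set v | (v <= M.+1)%N]) V v =
   (\bigcup_(v in [set v | (v <= M)%N]) V v) `|` V M.+1 by exact: UU.
apply/seteqP; split => [x [v /= + Vx]|x [[v /= vM Vx]|Vx]].
- rewrite leq_eqVlt => /predU1P[<-|]; first by right.
  by rewrite ltnS => vM; left; exists v.
- by exists v => //=; exact: leqW.
- by exists M.+1 => /=.
Qed.

Definition bounded_by (m f : nat -> nat) := forall k, (f k <= m k)%N.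

(** A family that looks only at the first [n] coordinates is in effect indexed by
    the finite box below [m]. *)
Lemma box_bigcup_closed (U : set (set X)) (m : nat -> nat) n
    (V : (nat -> nat) -> set X) :
  (forall K L, U K -> U L -> U (K `|` L)) ->
  (forall f, U (V f)) -> (forall f g, agree n f g -> V f = V g) ->
  U (\bigcup_(f in bounded_by m) V f).
Proof.
move=> UU; elim: n V => [|n IH] V UV Vn.
  suff -> : \bigcup_(f in bounded_by m) V f = V m by [].
  apply/seteqP; split => [x [f _ Vx]|x Vx]; last by exists m => // k.
  by rewrite (Vn m f).
suff -> : \bigcup_(f in bounded_by m) V f =
    \bigcup_(v in [set v | (v <= m n)%N])
      \bigcup_(f in bounded_by m) V (update f n v).
  apply: bounded_bigcup_closed => // v; apply: IH => // f g fg.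
  exact/Vn/agree_update2.
apply/seteqP; split => [x [f fm Vx]|x [v /= vm [f fm Vx]]].
  exists (f n); first exact: fm.
  by exists f => //; rewrite (Vn _ f)//; exact/agree_sym/agree_update_eq.
exists (update f n v) => // k; rewrite /update; case: eqP => [->//|_]; exact: fm.
Qed.

(** Koenig's lemma in the box below [m]: a prefix that extends to solutions of all
    the conditions keeps this property for one of the finitely many values of its next
    coordinate, for otherwise the strongest of the conditions that fail would have no
    solution extending it. *)
Lemma box_compact (m : nat -> nat) (Q : nat -> (nat -> nat) -> Prop) :
  (forall n, finitely_dependent (Q n)) ->
  (forall n f, Q n.+1 f -> Q n f) ->
  (forall n, exists2 f, bounded_by m f & Q n f) ->
  exists f, forall n, Q n f.
Proof.
move=> Qdep Qdec Qne.
have {}Qdec n p f : (n <= p)%N -> Q p f -> Q n f.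
  by move=> /subnK <-; elim: (p - n)%N => // k IH /Qdec.
pose R n f := forall N, exists2 g, bounded_by m g & agree n f g /\ Q N g.
have [||n f Rf|f Rf] := @infinite_branch R m.
- move=> n f g fg Rf N; have [h hm [fh Qh]] := Rf N.
  by exists h => //; split => //; apply: agree_trans fh; exact: agree_sym.
- by move=> N; have [g gm Qg] := Qne N; exists g.
- apply: contrapT => /forallNP nR.
  have /choice[N NP] v : exists N, ~ exists2 g, bounded_by m g &
      agree n.+1 (update f n v) g /\ Q N g.
    exact/existsNP/nR.
  pose M := (\max_(v < (m n).+1) N v)%N.
  have [g gm [fg Qg]] := Rf M.
  apply: (NP (g n)); exists g => //; split.
    exact/agree_sym/agree_update_eq/agree_sym.
  apply: Qdec Qg.
  have gn : (g n < (m n).+1)%N by rewrite ltnS.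
  exact: (@leq_bigmax _ (fun v : 'I_(m n).+1 => N v) (Ordinal gn)).
exists f => n; have [N QN] := Qdep n.
by have [g _ [fg]] := Rf N n; rewrite (QN _ _ fg).
Qed.

(** Choquet's capacitability theorem. The bounds [m] on the coordinates are chosen one
    after the other, keeping [C] at each step because the sets increase with the bound.
    Once the coordinates are bounded by [m], what the first [n] of them impose is a
    finite union of finite intersections, and compactness of the box puts the
    intersection over [n] inside [S]. *)
Lemma capacitability E (U : set (set X)) (C : set (set X)) S :
  E setT -> (forall K L, E K -> E L -> E (K `&` L)) ->
  E `<=` U -> (forall K L, U K -> U L -> U (K `|` L)) ->
  (forall K L, K `<=` L -> C K -> C L) ->
  (forall K : (set X)^nat, (forall n, K n `<=` K n.+1) ->
     C (\bigcup_n K n) -> exists n, C (K n)) ->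
  analytic E S -> C S ->
  exists K : (set X)^nat, [/\ forall n, U (K n), forall n, C (K n),
    nonincreasing_seq K & \bigcap_n K n `<=` S].
Proof.
move=> ET EI EU UU Cmono Ccont [A [EA dA SA]] CS.
have /choice[N NP] := dA.
(* The part of [S] reached by sequences whose first [n] coordinates are bounded. *)
pose B n m := [set x | exists2 f, (forall k, (k < n)%N -> (f k <= m k)%N) &
  forall j, A j f x].
have [||n m|m Cm] := @infinite_branch (fun n m => C (B n m)) id.
- move=> n f g fg; apply: Cmono => x [h hf Ah]; exists h => // k kn.
  by rewrite -fg//; exact: hf.
- by move: CS; rewrite SA; apply: Cmono => x [f Af]; exists f.
- move=> CB; apply: (Ccont (fun v => B n.+1 (update m n v))).
    move=> v x [f fm Af]; exists f => // k kn; apply: leq_trans (fm _ kn) _.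
    by rewrite /update; case: eqP.
  move: CB; apply: Cmono => x [f fm Af]; exists (f n) => //; exists f => // k.
  rewrite ltnS leq_eqVlt => /predU1P[->|kn]; first by rewrite /update eqxx.
  by rewrite /update ltn_eqF// fm.
(* The conditions among the first [n] that read the first [n] coordinates only. *)
pose V n f := \bigcap_(j in [set j | (j < n)%N /\ (N j <= n)%N]) A j f.
have Vn n f g : agree n f g -> V n f = V n g.
  move=> fg; apply: eq_bigcapr => j [_ jn]; apply: NP; exact: agree_le fg.
have EV n f : E (V n f).
  rewrite /V.
  have: forall p, E (\bigcap_(j in [set j | (j < p)%N /\ (N j <= n)%N]) A j f).
    elim=> [|p IH].
      rewrite (_ : [set _ | _] = set0) ?bigcap_set0//.
      by apply/seteqP; split => // j [].
    have [Np|Np] := pselect (N p <= n)%N.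
      rewrite (_ : [set _ | _] = p |` [set j | (j < p)%N /\ (N j <= n)%N]).
        by rewrite bigcap_setU1; exact: EI.
      apply/seteqP; split => [j [+ jn]|j [->|[jp jn]]]; last 2 first.
      - by split.
      - by split => //; exact: leqW.
      by rewrite ltnS leq_eqVlt => /predU1P[->|]; [left|right].
    rewrite (_ : [set _ | _] = [set j | (j < p)%N /\ (N j <= n)%N])//.
    apply/seteqP; split => [j [+ jn]|j [jp jn]]; last by split => //; exact: leqW.
    by rewrite ltnS leq_eqVlt => /predU1P[jp|]; [rewrite jp in jn|split].
  exact.
exists (fun n => \bigcup_(f in bounded_by m) V n f); split.
- by move=> n; apply: (@box_bigcup_closed _ _ n) => // [f|f g]; [exact/EU|exact: Vn].
- move=> n; apply: Cmono (Cm n) => x [f fm Af].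
  exists (fun k => if (k < n)%N then f k else 0%N).
    by move=> k; case: ifP => // kn; exact: fm.
  rewrite -(Vn n f) => [|k ->//]; by move=> j _; exact: Af.
- apply/nonincreasing_seqP => n; apply/subsetPset => x [f fm Vf].
  by exists f => // j [jn Nj]; apply: Vf; split; exact: leqW.
- move=> x Kx; rewrite SA.
  have [n|n f Vf|n|f Vf] := @box_compact m (fun n f => V n f x).
  + by exists n => f g fg; rewrite (Vn _ _ _ fg).
  + by move=> j [jn Nj]; apply: Vf; split; exact: leqW.
  + by have [f fm Vf] := Kx n I; exists f.
  exists f => j; apply: (Vf (maxn j.+1 (N j))).
  by split; rewrite leq_max ?ltnSn ?leqnn ?orbT.
Qed.

End analytic.

(** * Optional and predictable times *)

Section times.
Context {T : pointedType} {R : realType}.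
Variable F : {nonneg R} -> set (set T).
Hypothesis hF : is_filtration F.
Implicit Types (rho sigma tau : T -> \bar R).

Lemma filtration_sub (s t : {nonneg R}) : (s%:num <= t%:num)%R -> F s `<=` F t.
Proof. by case: hF => _; apply. Qed.

Lemma filtrationE t : F t = @measurable _ (g_sigma_algebraType (F t)).
Proof. by rewrite [RHS]sigma_algebra_id//; case: hF. Qed.

Lemma filtrationC t A : F t A -> F t (~` A).
Proof. by rewrite filtrationE; exact: measurableC. Qed.

Lemma filtrationI t A B : F t A -> F t B -> F t (A `&` B).
Proof. by rewrite filtrationE; exact: measurableI. Qed.

Lemma filtrationU t A B : F t A -> F t B -> F t (A `|` B).
Proof. by rewrite filtrationE; exact: measurableU. Qed.

Lemma filtrationT t : F t setT.
Proof. by rewrite filtrationE. Qed.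

Lemma filtration0 t : F t set0.
Proof. by rewrite filtrationE. Qed.

Lemma filtration_bigcup t (I : countType) (A : I -> set T) :
  (forall i, F t (A i)) -> F t (\bigcup_i A i).
Proof. by rewrite filtrationE; apply: countable_bigcupT_measurable. Qed.

Lemma filtration_bigcap t (I : countType) (A : I -> set T) :
  (forall i, F t (A i)) -> F t (\bigcap_i A i).
Proof.
move=> FA; rewrite -[X in F t X]setCK setC_bigcap; apply: filtrationC.
by apply: filtration_bigcup => i; exact: filtrationC.
Qed.

Lemma optional_cst (c : \bar R) : 0 <= c -> is_optional_time F (cst c).
Proof.
move=> c0; split => // t; have [ct|ct] := boolP (c <= t%:num%:E).
  by rewrite (_ : [set _ | _] = setT); [exact: filtrationT|apply/seteqP; split].
rewrite (_ : [set _ | _] = set0); first exact: filtration0.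
by apply/seteqP; split => // w /=; exact/negP.
Qed.

Lemma optional_min sigma tau : is_optional_time F sigma ->
  is_optional_time F tau -> is_optional_time F (fun w => mine (sigma w) (tau w)).
Proof.
move=> [s0 Fs] [t0 Ft]; split => [w|t]; first by rewrite le_min s0 t0.
rewrite (_ : [set _ | _] = [set w | sigma w <= t%:num%:E] `|`
  [set w | tau w <= t%:num%:E]); first exact: filtrationU.
by apply/seteqP; split => w /=; rewrite ge_min => /orP.
Qed.

Lemma optional_max sigma tau : is_optional_time F sigma ->
  is_optional_time F tau -> is_optional_time F (fun w => maxe (sigma w) (tau w)).
Proof.
move=> [s0 Fs] [t0 Ft]; split => [w|t]; first by rewrite le_max s0.
rewrite (_ : [set _ | _] = [set w | sigma w <= t%:num%:E] `&`
  [set w | tau w <= t%:num%:E]); first exact: filtrationI.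
by apply/seteqP; split => w /=; rewrite ge_max => /andP.
Qed.

Lemma optional_le_at sigma (s t : {nonneg R}) : is_optional_time F sigma ->
  (s%:num <= t%:num)%R -> F t [set w | sigma w <= s%:num%:E].
Proof. by move=> [_ Fs] st; exact: (filtration_sub st). Qed.

(** If [tau w < sigma w <= t], then a rational number separates the two times and
    lies below [t], so that the comparison is decided by [F t]. *)
Lemma optional_restrict sigma tau : is_optional_time F sigma ->
  is_optional_time F tau ->
  is_optional_time F (fun w => if sigma w <= tau w then sigma w else +oo).
Proof.
move=> os ot; have [s0 _] := os; have [t0 _] := ot.
split => [w|t]; first by case: ifP.
pose A (q : rat) := if pselect (0 <= (ratr q : R) <= t%:num)%R is left _ then
  [set w | tau w <= (ratr q)%:E] `&` ~` [set w | sigma w <= (ratr q)%:E] else set0.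
have FA q : F t (A q).
  rewrite /A; case: pselect => [/andP[q0 qt]|_]; last exact: filtration0.
  apply: filtrationI; first exact: (@optional_le_at _ (NngNum q0)).
  by apply: filtrationC; exact: (@optional_le_at _ (NngNum q0)).
rewrite (_ : [set _ | _] = [set w | sigma w <= t%:num%:E] `&` ~` \bigcup_q A q).
  apply: filtrationI; first exact: optional_le_at.
  exact/filtrationC/filtration_bigcup.
apply/seteqP; split => w /=.
  case: ifPn => // st sle; split => // -[q _]; rewrite /A.
  by case: pselect => // _ [/= tq]; apply; exact: le_trans tq.
move=> [sle nA]; case: ifPn => //; rewrite -ltNge => ts; exfalso; apply: nA.
have tfin : tau w \is a fin_num.
  by rewrite ge0_fin_numE//; exact: lt_trans ts (le_lt_trans sle (ltry _)).
have sfin : sigma w \is a fin_num.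
  by rewrite ge0_fin_numE//; exact: le_lt_trans sle (ltry _).
have [q] := rat_in_itvoo (fine_lt tfin sfin ts).
rewrite in_itv/= => /andP[tq qs]; exists q => //; rewrite /A.
have {}tq : tau w < (ratr q)%:E by rewrite -(fineK tfin) lte_fin.
have {}qs : (ratr q)%:E < sigma w by rewrite -(fineK sfin) lte_fin.
case: pselect => [_|[]]; first by split; [exact: ltW|by apply/negP; rewrite -ltNge].
apply/andP; split; rewrite -lee_fin; first exact: le_trans (ltW tq).
exact: le_trans (ltW qs) sle.
Qed.

(** A weakening of announcement in which the family need be neither monotone nor
    finite; it determines the same times ([foretold_predictable]) and is much easier
    to verify. *)
Definition foretold (I : Type) (tau : I -> T -> \bar R) rho :=
  [/\ forall i, is_optional_time F (tau i),
      forall i w, tau i w <= rho w,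
      forall i w, 0 < rho w < +oo -> tau i w < rho w &
      forall w x, x < rho w -> exists i, x < tau i w].

Lemma predictable_foretold rho : is_predictable_time F rho ->
  exists2 tau : nat -> T -> \bar R, foretold tau rho &
    forall n w, 0 < rho w -> tau n w < rho w.
Proof.
move=> [_ [tau [otau [ndtau _ letau lttau cvtau]]]]; exists tau => //; split => //.
  by move=> n w /andP[r0 _]; exact: lttau.
move=> w x xrho.
have := ereal_nondecreasing_cvgn (ndtau w).
move=> /(cvg_unique (@ereal_hausdorff R) (cvtau w)) E.
by move: xrho; rewrite E => /ereal_sup_gt[_ [n _ <-]]; exists n.
Qed.

(** Running maxima make the family monotone, and truncating the [n]-th one at [n] makes
    it finite. Where [rho] is [+oo] the truncation also yields strictness, which is why
    [foretold] asks for strictness only where [rho] is finite. *)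
Lemma foretold_predictable (I : countType) (tau : I -> T -> \bar R) rho :
  (forall w, 0 <= rho w) -> foretold tau rho -> is_predictable_time F rho.
Proof.
move=> rho0 [ otau letau lttau suptau].
have orho : is_optional_time F rho.
  split => // t.
  rewrite (_ : [set _ | _] = \bigcap_i [set w | tau i w <= t%:num%:E]).
    by apply: filtration_bigcap => i; case: (otau i).
  apply/seteqP; split => w /=; first by move=> rt i _; exact: le_trans rt.
  move=> taut; rewrite leNgt; apply/negP => /suptau[i]; apply/negP.
  by rewrite -leNgt; exact: taut.
split => //.
pose u n : T -> \bar R := if unpickle n is Some i then tau i else cst 0.
have ou n : is_optional_time F (u n).
  by rewrite /u; case: unpickle => //; exact: optional_cst.
have leu n w : u n w <= rho w by rewrite /u; case: unpickle => /=.
have ltu n w : 0 < rho w < +oo -> u n w < rho w.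
  by rewrite /u; case: unpickle => [i|/andP[]//]; exact: lttau.
pose fix v n := if n is k.+1 then fun w => maxe (v k w) (u k w) else cst 0.
have ov n : is_optional_time F (v n).
  by elim: n => [|n IH] /=; [exact: optional_cst|exact: optional_max].
have lev n w : v n w <= rho w by elim: n => //= n IH; rewrite ge_max IH leu.
have ltv n w : 0 < rho w < +oo -> v n w < rho w.
  move=> r0; elim: n => [|n IH] /=; first by case/andP: r0.
  by rewrite gt_max IH ltu.
have ndv w : nondecreasing_seq (v ^~ w).
  by apply/nondecreasing_seqP => n /=; rewrite le_max lexx.
pose z n w := mine (v n w) n%:R%:E.
have ndz w : nondecreasing_seq (z ^~ w).
  move=> m n mn; rewrite /z le_min !ge_min (ndv w m n mn)/=.
  by rewrite lee_fin ler_nat mn orbT.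
exists z; split.
  by move=> n; apply: optional_min => //; apply: optional_cst; rewrite lee_fin.
split => //.
- by move=> n w; rewrite gt_min ltry orbT.
- by move=> n w; rewrite ge_min lev.
- move=> n w r0; have [rfin|] := boolP (rho w < +oo).
    by rewrite gt_min ltv// r0.
  by rewrite -leNgt leye_eq => /eqP ->; rewrite gt_min ltry orbT.
- move=> w; have := ereal_nondecreasing_cvgn (ndz w).
  suff -> : ereal_sup (range (z ^~ w)) = rho w by [].
  apply/eqP; rewrite eq_le; apply/andP; split.
    by apply/ereal_supP => _ [n _ <-]; rewrite ge_min lev.
  rewrite leNgt; apply/negP; set s := ereal_sup _ => srho.
  have s0 : 0 <= s.
    by apply: le_ereal_sup_tmp; exists (z 0%N w); [exists 0%N|rewrite /z le_min/= lexx].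
  have [i sv] := suptau w s srho.
  have {}sv : s < v (pickle i).+1 w.
    by rewrite /= lt_max /u pickleK sv orbT.
  have sfin : s \is a fin_num.
    by rewrite ge0_fin_numE//; exact: lt_le_trans srho (leey _).
  have [n sn] : exists n : nat, s < n%:R%:E.
    exists (Num.truncn (fine s)).+1; rewrite -(fineK sfin) lte_fin.
    exact: truncnS_gt.
  pose p := maxn n (pickle i).+1.
  have : s < z p w.
    rewrite lt_min; apply/andP; split.
      by apply: lt_le_trans sv _; apply: ndv; exact: leq_maxr.
    by apply: lt_le_trans sn _; rewrite lee_fin ler_nat leq_maxl.
  by apply/negP; rewrite -leNgt; apply: ereal_sup_ubound; exists p.
Qed.

Lemma predictable_ge0 rho w : is_predictable_time F rho -> 0 <= rho w.
Proof. by case => -[]. Qed.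

Lemma predictable_cst (c : \bar R) : c = 0 \/ c = +oo -> is_predictable_time F (cst c).
Proof.
move=> c0y; have c0 : 0 <= c by case: c0y => ->.
apply: (@foretold_predictable unit (fun _ => cst c)) => //; split => //.
- by move=> _; exact: optional_cst.
- by move=> _ w; case: c0y => ->; rewrite ltxx ?andbF.
Qed.

Lemma predictable_sup (rho : nat -> T -> \bar R) :
  (forall n, is_predictable_time F (rho n)) ->
  is_predictable_time F (fun w => ereal_sup (range (rho ^~ w))).
Proof.
move=> prho.
have lesup n w : rho n w <= ereal_sup (range (rho ^~ w)).
  by apply: ereal_sup_ubound; exists n.
have /choice[tau tauP] n : exists tau : nat -> T -> \bar R,
    foretold tau (rho n) /\ forall k w, 0 < rho n w -> tau k w < rho n w.
  by have [tau] := predictable_foretold (prho n); exists tau.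
apply: (@foretold_predictable (nat * nat)%type (fun p => tau p.1 p.2)).
  by move=> w; apply: le_trans (lesup 0%N w); exact: predictable_ge0.
split.
- by move=> [n k]; case: (tauP n) => -[].
- move=> [n k] w; have [[_ leta _ _] _] := tauP n.
  exact: le_trans (leta k w) (lesup n w).
- move=> [n k] w /andP[r0 _] /=; have [_ ltta] := tauP n.
  have [rn0|] := ltP 0 (rho n w); first exact: lt_le_trans (ltta k w rn0) (lesup n w).
  move=> rn0; apply: le_lt_trans r0; apply: le_trans rn0.
  by have [[_ leta _ _] _] := tauP n; exact: leta.
- move=> w x /ereal_sup_gt[_ [n _ <-]] xr; have [[_ _ _ sup] _] := tauP n.
  by have [k xk] := sup w x xr; exists (n, k).
Qed.

Lemma predictable_max rho1 rho2 : is_predictable_time F rho1 ->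
  is_predictable_time F rho2 -> is_predictable_time F (fun w => maxe (rho1 w) (rho2 w)).
Proof.
move=> p1 p2.
have := @predictable_sup (fun n => if n is 0 then rho1 else rho2).
rewrite (_ : (fun w => ereal_sup _) = (fun w => maxe (rho1 w) (rho2 w))).
  by apply; case.
apply/funext => w; apply/eqP; rewrite eq_le; apply/andP; split.
  by apply/ereal_supP => _ [[|n] _ <-]; rewrite le_max lexx ?orbT.
rewrite ge_max; apply/andP; split.
  by apply: ereal_sup_ubound; exists 0%N.
by apply: ereal_sup_ubound; exists 1%N.
Qed.

Lemma predictable_min rho1 rho2 : is_predictable_time F rho1 ->
  is_predictable_time F rho2 -> is_predictable_time F (fun w => mine (rho1 w) (rho2 w)).
Proof.
move=> p1 p2.
have [tau1 [ ot1 le1 _ sup1] lt1] := predictable_foretold p1.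
have [tau2 [ ot2 le2 _ sup2] lt2] := predictable_foretold p2.
apply: (@foretold_predictable (nat * nat)%type
  (fun p w => mine (tau1 p.1 w) (tau2 p.2 w))).
  by move=> w; rewrite le_min !predictable_ge0.
split.
- by move=> [i j]; exact: optional_min.
- by move=> [i j] w /=; rewrite le_min !ge_min le1 le2 orbT.
- move=> [i j] w /=; rewrite lt_min => /andP[/andP[r1 r2] _].
  by rewrite lt_min !gt_min lt1// lt2// orbT.
- move=> w x; rewrite lt_min => /andP[/sup1[i xi] /sup2[j xj]].
  by exists (i, j); rewrite lt_min xi.
Qed.

(** The event [sigma <= tau] belongs to the information strictly before [sigma]: once
    [tau < sigma], some time foretelling [sigma] exceeds [tau]. *)
Lemma predictable_restrict sigma tau : is_predictable_time F sigma ->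
  is_optional_time F tau ->
  is_predictable_time F (fun w => if sigma w <= tau w then sigma w else +oo).
Proof.
move=> ps ot; have [s [ ots les lts sups] _] := predictable_foretold ps.
apply: (@foretold_predictable nat
  (fun n w => if s n w <= tau w then s n w else +oo)).
  by move=> w; case: ifP => // _; exact: predictable_ge0.
split.
- by move=> n; exact: optional_restrict.
- move=> n w; case: (leP (sigma w) (tau w)) => [st|_]; last exact: leey.
  by rewrite (le_trans (les n w) st).
- move=> n w; case: (leP (sigma w) (tau w)) => [st|_]; last by rewrite ltxx andbF.
  by rewrite (le_trans (les n w) st); exact: lts.
- move=> w x; case: ifPn => [st /sups[n xn]|].
    by exists n; case: ifP => // _; exact: lt_le_trans xn (leey _).
  rewrite -ltNge => /sups[n tn] xy; exists n.
  by rewrite leNgt tn.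
Qed.

(** A time with values in [{0, +oo}] foretells itself. *)
Lemma predictable_indic0 (A : set T) : F (0%R%:nng)%R A ->
  is_predictable_time F (fun w => if w \in A then 0 else +oo).
Proof.
move=> FA; set rho := fun w => _.
have rho0 w : 0 <= rho w by rewrite /rho; case: ifP.
apply: (@foretold_predictable unit (fun _ => rho)) => //; split => //.
- move=> _; split => // t; rewrite (_ : [set _ | _] = A).
    by apply: filtration_sub FA => /=.
  apply/seteqP; split => w /=; rewrite /rho; first by case: ifPn => // /set_mem.
  by move=> /mem_set ->.
- by move=> _ w; rewrite /rho; case: ifP; rewrite ltxx ?andbF.
Qed.

End times.

(** * The paving of stochastic intervals *)

Section intervals.
Context {T : pointedType} {R : realType}.
Variable F : {nonneg R} -> set (set T).
Hypothesis hF : is_filtration F.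
Implicit Types (rho sigma tau : T -> \bar R) (K L : set (T * {nonneg R})).

Definition interval sigma tau : set (T * {nonneg R}) :=
  [set x | sigma x.1 <= x.2%:num%:E <= tau x.1].

Definition intervals : set (set (T * {nonneg R})) :=
  [set K | exists sigma tau, [/\ is_predictable_time F sigma,
     is_optional_time F tau & K = interval sigma tau]].

Lemma intervals_setT : intervals setT.
Proof.
exists (cst 0), (cst +oo); split.
- by apply: predictable_cst => //; left.
- exact: optional_cst.
- by apply/seteqP; split => // x _; rewrite /interval/= lee_fin ge0 leey.
Qed.

Lemma intervals_set0 : intervals set0.
Proof.
exists (cst +oo), (cst +oo); split.
- by apply: predictable_cst => //; right.
- exact: optional_cst.
- by apply/seteqP; split => // x; rewrite /interval/= leye_eq.
Qed.

Lemma intervals_setI K L : intervals K -> intervals L -> intervals (K `&` L).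
Proof.
move=> [s [t [ps ot ->]]] [s' [t' [ps' ot' ->]]].
exists (fun w => maxe (s w) (s' w)), (fun w => mine (t w) (t' w)); split.
- exact: predictable_max.
- exact: optional_min.
- apply/seteqP; split => x; rewrite /interval/= ge_max le_min.
    by move=> [/andP[-> ->] /andP[-> ->]].
  by move=> /andP[/andP[-> ->] /andP[-> ->]].
Qed.

Lemma analytic_epigraph rho : is_predictable_time F rho ->
  analytic intervals (time_epigraph rho).
Proof.
move=> prho; apply: analytic_paving; exists rho, (cst +oo); split => //.
  exact: optional_cst.
by apply/seteqP; split => x; rewrite /interval/= leey andbT.
Qed.

(** The times that announce [rho] exhaust the complement of its epigraph by
    intervals closed on the right. *)
Lemma analytic_setC_epigraph rho : is_predictable_time F rho ->
  analytic intervals (~` time_epigraph rho).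
Proof.
move=> prho; have [[rho0 Frho] _] := prho.
have [tau [ot le _ sup] lt] := predictable_foretold prho.
pose sigma w : \bar R := if w \in [set w | 0 < rho w] then 0 else +oo.
rewrite (_ : ~` _ = \bigcup_n interval sigma (tau n)).
  apply: analytic_bigcup => [|n]; first exact: intervals_setT.
  apply: analytic_paving; exists sigma, (tau n); split => //.
  apply: predictable_indic0 => //.
  rewrite (_ : [set _ | _] = ~` [set w | rho w <= 0]).
    by apply: filtrationC => //; exact: (Frho (0%R%:nng)%R).
  by apply/seteqP; split => w /=; rewrite ltNge => /negP.
apply/seteqP; split => [[w t]|[w t] [n _]]; rewrite /time_epigraph /interval /sigma/=.
  move=> /negP; rewrite -ltNge => trho; have [n tn] := sup _ _ trho.
  exists n => //=; rewrite mem_set/=; first by rewrite lee_fin ge0/= ltW.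
  by apply: le_lt_trans trho; rewrite lee_fin ge0.
case: ifPn => [/set_mem/= r0 /andP[_ tn]|_]; last by rewrite leye_eq.
by apply/negP; rewrite -ltNge; exact: le_lt_trans tn (lt _ _ r0).
Qed.

Lemma predictable_analytic S : predictable_sigma_algebra F S -> analytic intervals S.
Proof.
apply: analytic_sigma_algebra; [exact: intervals_setT|exact: intervals_set0|].
move=> _ [rho prho <-]; split; first exact: analytic_epigraph.
exact: analytic_setC_epigraph.
Qed.

Definition debut rho K := [/\ is_predictable_time F rho, time_graph rho `<=` K &
  forall x, K x -> rho x.1 <= x.2%:num%:E].

(** The limits that matter are those of increasing sequences of debuts, so closedness
    is only asked from the left. It is stated on the complement, for which finite
    unions are immediate. *)
Definition left_closed K := forall w t, ~ K (w, t) ->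
  exists2 x : \bar R, x < t%:num%:E & forall s : {nonneg R},
    x < s%:num%:E <= t%:num%:E -> ~ K (w, s).

Definition has_predictable_debut K := left_closed K /\ exists rho, debut rho K.

Lemma interval_has_predictable_debut : intervals `<=` has_predictable_debut.
Proof.
move=> _ [sigma [tau [ps ot ->]]]; split.
  move=> w t; rewrite /interval/= => /negP; rewrite negb_and -!ltNge => /orP[ts|tt].
    exists (-oo); first exact: ltNyr.
    move=> s /andP[_ st] /andP[+ _].
    by apply/negP; rewrite -ltNge; exact: le_lt_trans ts.
  exists (tau w) => // s /andP[ts _] /andP[_].
  by apply/negP; rewrite -ltNge.
exists (fun w => if sigma w <= tau w then sigma w else +oo); split.
- exact: predictable_restrict.
- move=> [w t]; rewrite /time_graph /interval/=; case: ifPn => // st <-.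
  by rewrite lexx.
- move=> [w t]; rewrite /interval/= => /andP[st tt].
  by rewrite (le_trans st tt).
Qed.

Lemma has_predictable_debutU K L : has_predictable_debut K ->
  has_predictable_debut L -> has_predictable_debut (K `|` L).
Proof.
move=> [cK [rK [pK gK lK]]] [cL [rL [pL gL lL]]]; split.
  move=> w t /not_orP[/cK[x xt xK] /cL[y yt yL]].
  exists (maxe x y); first by rewrite gt_max xt yt.
  move=> s; rewrite gt_max => /andP[/andP[xs ys] st] [|]; [apply: xK|apply: yL].
    by rewrite xs.
  by rewrite ys.
exists (fun w => mine (rK w) (rL w)); split; first exact: predictable_min.
- move=> [w t]; rewrite /time_graph/=.
  by case: leP => _ E; [left; exact: gK|right; exact: gL].
- by move=> [w t] [/lK|/lL] /= le; rewrite ge_min le ?orbT.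
Qed.

Lemma nonneg_ereal (x : \bar R) : 0 <= x -> x < +oo ->
  exists t : {nonneg R}, x = t%:num%:E.
Proof.
case: x => [r| |] //; rewrite lee_fin => r0 _.
by exists (NngNum r0).
Qed.

Lemma debut_finite K rho w : debut rho K -> rho w < +oo ->
  exists2 t : {nonneg R}, rho w = t%:num%:E & K (w, t).
Proof.
move=> [prho gK _] /(nonneg_ereal (predictable_ge0 w prho))[t rt].
by exists t => //; exact: gK.
Qed.

Lemma debut_le K L rho sigma w : K `<=` L -> debut rho K -> debut sigma L ->
  sigma w <= rho w.
Proof.
move=> KL dK [_ _ leL]; have [/(debut_finite dK)[t -> Kt]|] := ltP (rho w) +oo.
  exact: (leL (w, t) (KL _ Kt)).
by rewrite leye_eq => /eqP ->; rewrite leey.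
Qed.

(** The debut of [K k] reaches a point that lies in all the earlier sets. If the limit
    of these debuts were outside [K n], so would be all the points shortly before it,
    among which are the later debuts. *)
Lemma debut_bigcap (K : nat -> set (T * {nonneg R})) (rho : nat -> T -> \bar R) :
  nonincreasing_seq K -> (forall n, left_closed (K n)) ->
  (forall n, debut (rho n) (K n)) ->
  time_graph (fun w => ereal_sup (range (rho ^~ w))) `<=` \bigcap_n K n.
Proof.
move=> Kdec cK dK [w t]; rewrite /time_graph/= => rt n _.
apply: contrapT => /cK[x xt xK].
have Kle k p : (k <= p)%N -> K p `<=` K k by move=> /Kdec /subsetPset.
have le k : rho k w <= t%:num%:E by rewrite -rt; apply: ereal_sup_ubound; exists k.
move: xt; rewrite -rt => /ereal_sup_gt[_ [k _ <-] xk].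
have [s rs Ks] := debut_finite (dK (maxn k n)) (le_lt_trans (le _) (ltry _)).
apply: (xK s); last exact: Kle (leq_maxr _ _) _ Ks.
rewrite -rs le andbT; apply: lt_le_trans xk _.
by apply: debut_le (dK _) (dK _); apply: Kle; exact: leq_maxl.
Qed.

End intervals.

(** * Continuity of the outer probability *)

Section outer.
Context {d : measure_display} {T : measurableType d} {R : realType}.
Variable P : probability T R.

Lemma outer_probability_le A B : A `<=` B ->
  outer_probability P A <= outer_probability P B.
Proof.
move=> AB; apply: ereal_inf_le_tmp => _ [E [BE mE] <-]; exists E => //.
by split => //; exact: subset_trans BE.
Qed.

Lemma outer_probability_measurable A : measurable A -> outer_probability P A <= P A.
Proof. by move=> mA; apply: ereal_inf_lbound; exists A; [split|]. Qed.

Lemma outer_probability_fin_num A : outer_probability P A \is a fin_num.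
Proof.
have out0 : 0 <= outer_probability P A.
  by apply: le_ereal_inf_tmp => _ [E _ <-]; exact: measure_ge0.
rewrite ge0_fin_numE//.
apply: le_lt_trans (outer_probability_le (@subsetT _ A)) _.
apply: le_lt_trans (outer_probability_measurable measurableT) _.
by rewrite probability_setT ltry.
Qed.

Lemma measurable_hull A (a : R) : outer_probability P A <= a%:E ->
  exists E, [/\ A `<=` E, measurable E & P E <= a%:E].
Proof.
move=> Aa.
have /choice[E /all_and3[AE mE PE]] n : exists E,
    [/\ A `<=` E, measurable E & P E < (a + n.+1%:R^-1)%:E].
  have : outer_probability P A < (a + n.+1%:R^-1)%:E.
    by apply: le_lt_trans Aa _; rewrite lte_fin ltrDl invr_gt0.
  by move=> /ereal_inf_lt[_ [E [AE mE] <-] PE]; exists E.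
exists (\bigcap_n E n); split.
- by move=> x Ax n _; exact: AE.
- exact: bigcapT_measurable.
- apply/lee_addgt0Pr => e e0.
  have [n ne] : exists n : nat, (n.+1%:R^-1 < e)%R.
    exists (Num.truncn e^-1); rewrite invf_plt ?posrE//; exact: truncnS_gt.
  apply: (@le_trans _ _ (P (E n))).
    by apply: le_measure; rewrite ?inE//; [exact: bigcapT_measurable|exact: bigcap_inf].
  by apply: ltW; apply: lt_trans (PE n) _; rewrite lte_fin ltrD2l.
Qed.

(** Measurable hulls [E n] of the [A n] may fail to increase; the intersections of
    their tails do increase, still cover, and have no larger probability. *)
Lemma outer_probability_bigcup (A : (set T)^nat) (a : R) :
  (forall n, A n `<=` A n.+1) -> a%:E < outer_probability P (\bigcup_n A n) ->
  exists n, a%:E < outer_probability P (A n).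
Proof.
move=> Ainc; apply: contraPP => /forallNP nA; apply/negP; rewrite -leNgt.
have Ale k p : (k <= p)%N -> A k `<=` A p.
  by move=> /subnK <-; elim: (p - k)%N => // q IH; apply: subset_trans IH (Ainc _).
have /choice[E /all_and3[AE mE PE]] n : exists E,
    [/\ A n `<=` E, measurable E & P E <= a%:E].
  by apply: measurable_hull; rewrite leNgt; exact/negP.
pose G n := \bigcap_(k in [set k | (n <= k)%N]) E k.
have mG n : measurable (G n) by apply: bigcap_measurableType.
have mUG : measurable (\bigcup_n G n) by exact: bigcupT_measurable.
have AG n : A n `<=` G n by move=> x Ax k /= nk; exact/AE/(Ale _ _ nk).
have ndG : nondecreasing_seq G.
  move=> m n mn; apply/subsetPset => x Gx k /= nk; apply: Gx => /=; exact: leq_trans nk.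
apply: (@le_trans _ _ (P (\bigcup_n G n))).
  apply: ereal_inf_lbound; exists (\bigcup_n G n) => //; split => //.
  by move=> x [n _ Ax]; exists n => //; exact: AG.
have cvg := @nondecreasing_cvg_mu _ _ _ P _ mG mUG ndG.
rewrite -(cvg_lim (@ereal_hausdorff R) cvg).
apply: lime_le; first by apply/cvg_ex; eexists; exact: cvg.
apply: nearW => n /=; apply: le_trans (PE n).
by apply: le_measure; rewrite ?inE//; apply: bigcap_inf => /=.
Qed.

End outer.

(** * The section theorem *)

Theorem theorem3p3 (d : measure_display) (T : measurableType d) (R : realType)
    (P : probability T R) (F : {nonneg R} -> set (set T))
    (hF : is_filtration F)
    (hFsub : <<s \bigcup_(t in [set: {nonneg R}]) F t >> `<=` @measurable d T)
    (S : set (T * {nonneg R})) (hS : predictable_sigma_algebra F S)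
    (eps : R) (heps : (0 < eps)%R) :
  exists rho : T -> \bar R,
    [/\ is_predictable_time F rho,
        time_graph rho `<=` S &
        outer_probability P (fst @` S) - P [set w | rho w < +oo] <= eps%:E].
Proof.
have mF t A : F t A -> measurable A.
  by move=> FA; apply: hFsub; apply: sub_sigma_algebra; exists t.
have mle rho (t : {nonneg R}) : is_optional_time F rho ->
    measurable [set w | rho w <= t%:num%:E].
  by move=> [_ Frho]; exact: mF (Frho t).
(* Bounding the times makes [rho <= N] the limit of the events [rho_n <= N]; the events
   [rho_n < +oo] could decrease to something larger than [rho < +oo]. *)
pose proj (N : nat) (K : set (T * {nonneg R})) : set T :=
  [set w | exists2 t : {nonneg R}, K (w, t) & (t%:num <= N%:R)%R].
have out_fin := outer_probability_fin_num P (fst @` S).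
pose a := (fine (outer_probability P (fst @` S)) - eps)%R.
have aS : a%:E < outer_probability P (fst @` S).
  by rewrite -(fineK out_fin) lte_fin ltrBlDr ltrDl.
have [N aN] : exists N, a%:E < outer_probability P (proj N S).
  apply: outer_probability_bigcup.
    by move=> n w [t St tn]; exists t => //; apply: le_trans tn _; rewrite ler_nat.
  rewrite (_ : \bigcup_n _ = fst @` S)//.
  apply/seteqP; split => [w [n _ [t St _]]|_ [[w t] St <-]]; first by exists (w, t).
  exists (Num.truncn t%:num).+1 => //; exists t => //; apply/ltW; exact: truncnS_gt.
have [|||||K [UK CK Kdec KS]] := @capacitability _ (intervals F)
   (has_predictable_debut F) [set K | a%:E < outer_probability P (proj N K)] S
   (intervals_setT hF) _ _ _ _ _ (predictable_analytic hF hS) aN.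
- exact: intervals_setI.
- exact: interval_has_predictable_debut.
- exact: has_predictable_debutU.
- move=> K L KL /= aK; apply: lt_le_trans aK _; apply: outer_probability_le.
  by move=> w [t Kt tN]; exists t => //; exact: KL.
- move=> K Kinc /=; set G := proj N _ => aG.
  apply: outer_probability_bigcup.
    by move=> n w [t Kt tN]; exists t => //; exact: Kinc.
  rewrite (_ : \bigcup_n _ = G)//.
  apply/seteqP; split => [w [n _ [t Kt tN]]|w [t [n _ Kt] tN]].
    by exists t => //; exists n.
  by exists n => //; exists t.
have /choice[rho drho] n : exists rho, debut F rho (K n) by case: (UK n).
exists (fun w => ereal_sup (range (rho ^~ w))).
have prho n : is_predictable_time F (rho n) by case: (drho n).
have psup := predictable_sup hF prho.
pose G n := [set w | rho n w <= N%:R%:E].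
split => //.
  by apply: subset_trans KS; apply: debut_bigcap drho => // n; case: (UK n).
have mrho n : measurable (G n) by exact: (mle _ (NngNum (ler0n R N))) (proj1 (prho n)).
have mG : measurable (\bigcap_n G n) by exact: bigcapT_measurable.
have Gdec : nonincreasing_seq G.
  move=> n p np; apply/subsetPset => w; apply: le_trans.
  by apply: debut_le (drho _) (drho _); exact/subsetPset/Kdec.
have aG : a%:E <= P (\bigcap_n G n).
  have G0 : P (G 0%N) < +oo by rewrite ltey_eq fin_num_measure.
  have cvgG := @nonincreasing_cvg_mu _ _ _ P G G0 mrho mG Gdec.
  rewrite -(cvg_lim (@ereal_hausdorff R) cvgG).
  apply: lime_ge; first by apply/cvg_ex; eexists; exact: cvgG.
  apply: nearW => n /=; apply: le_trans (ltW (CK n)) _.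
  apply: le_trans (outer_probability_measurable P (mrho n)).
  apply: outer_probability_le => w [t Kt tN].
  have [_ _ leK] := drho n; apply: le_trans (leK _ Kt) _; by rewrite lee_fin.
have mfin : measurable [set w | ereal_sup (range (rho ^~ w)) < +oo].
  rewrite (_ : [set _ | _] = \bigcup_(n : nat)
      [set w | ereal_sup (range (rho ^~ w)) <= n%:R%:E]).
    apply: bigcupT_measurable => n.
    exact: (mle _ (NngNum (ler0n R n))) (proj1 psup).
  apply/seteqP; split => w /=.
    move=> /(nonneg_ereal (predictable_ge0 w psup))[t /= rt].
    by exists (Num.truncn t%:num).+1 => //=; rewrite rt lee_fin; exact/ltW/truncnS_gt.
  by move=> [n _ /= rn]; apply: le_lt_trans rn (ltry _).
rewrite -(fineK out_fin) leeBlDr ?fin_num_measure// addeC -leeBlDr// -EFinB.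
apply: le_trans aG _; apply: le_measure; rewrite ?inE// => w Gw /=.
apply: le_lt_trans (ltry N%:R); apply/ereal_supP => _ [n _ <-]; exact: Gw.
Qed.
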